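(* Let $(d_n)_{n\ge1}$ be a fixed sequence of integers $d_n\ge2$, $m\ge1$, and $c_i\in\{0,1,\dots,d_i-1\}$ for $i=1,\dots,m$. The nega-$D$-cylinder $\Delta^{-D}_{c_1c_2\ldots c_m}$ is a closed interval, and $$\Delta^{-D}_{c_1c_2\ldots c_m}=\left[g_m+\frac{(-1)^m}{d_1d_2\cdots d_m}(a_m-1);\ g_m+\frac{(-1)^m}{d_1d_2\cdots d_m}a_m\right]$$ if $m$ is even, and $$\Delta^{-D}_{c_1c_2\ldots c_m}=\left[g_m+\frac{(-1)^m}{d_1d_2\cdots d_m}a_m;\ g_m+\frac{(-1)^m}{d_1d_2\cdots d_m}(a_m-1)\right]$$ if $m$ is odd, where $$a_m=\sup\sum_{j=1}^{\infty}\frac{(-1)^j\varepsilon_{m+j}}{d_{m+1}d_{m+2}\cdots d_{m+j}},\qquad g_m=\sum_{i=1}^{m}\frac{(-1)^ic_i}{d_1d_2\cdots d_i},$$ the supremum being over all choices of digits $\varepsilon_{m+j}\in\{0,1,\dots,d_{m+j}-1\}$, $j\ge1$.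
   Context: Put $a_0=\sum_{n=1}^{\infty}\frac{(-1)^{n+1}}{d_1d_2\cdots d_n}$. For digits $\varepsilon_n\in\{0,\dots,d_n-1\}$ put $\Delta^{-D}_{\varepsilon_1\varepsilon_2\ldots}=\sum_{n=1}^{\infty}\frac{(-1)^n\varepsilon_n}{d_1d_2\cdots d_n}$; every number of $[a_0-1;a_0]$ has such a representation. The nega-$D$-cylinder $\Delta^{-D}_{c_1\ldots c_m}$ of rank $m$ with base $c_1\ldots c_m$ is the set of all numbers of $[a_0-1;a_0]$ having a representation $\Delta^{-D}_{\varepsilon_1\varepsilon_2\ldots}$ with $\varepsilon_i=c_i$ for $i=1,\dots,m$. *)

(* Defs.v *)
From HB Require Import structures.
From mathcomp Require Import all_boot all_order all_algebra.
From mathcomp Require Import all_classical all_reals all_analysis.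

Set Implicit Arguments.
Unset Strict Implicit.
Unset Printing Implicit Defensive.

Import Order.TTheory GRing.Theory Num.Theory.
Import numFieldNormedType.Exports.

Local Open Scope classical_set_scope.
Local Open Scope ring_scope.

(* Sequences d, eps, c : nat -> nat are indexed from 1; the value at 0 is never
   used. *)

(* u_1 + u_2 + ...: limn is total, but every series below converges absolutely
   when d n >= 2 and eps n < d n, so this is the genuine sum there. *)
Definition sum1 (R : realType) (u : nat -> R) : R :=
  limn (fun N => \sum_(1 <= n < N) u n : R).

(* d_{k+1} d_{k+2} ... d_{k+n} *)
Definition dprod (d : nat -> nat) (k n : nat) : nat :=
  (\prod_(k.+1 <= i < (k + n).+1) d i)%N.

(* eps_n is in {0, ..., d_n - 1} for every n > k *)
Definition digits_after (d : nat -> nat) (k : nat) (eps : nat -> nat) : Prop :=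
  forall n, (k < n)%N -> (eps n < d n)%N.

Definition negaD (R : realType) (d eps : nat -> nat) : R :=
  sum1 (fun n => (-1) ^+ n * (eps n)%:R / (dprod d 0 n)%:R).

Definition negaD_a0 (R : realType) (d : nat -> nat) : R :=
  sum1 (fun n => (-1) ^+ n.+1 / (dprod d 0 n)%:R).

Definition negaD_cylinder (R : realType) (d : nat -> nat) (m : nat)
    (c : nat -> nat) : set R :=
  [set x | x \in `[negaD_a0 R d - 1, negaD_a0 R d] /\
     exists eps, [/\ digits_after d 0 eps,
       (forall i, (1 <= i <= m)%N -> eps i = c i) & x = negaD R d eps]].
Arguments negaD_cylinder : clear implicits.

Definition negaD_a (R : realType) (d : nat -> nat) (m : nat) : R :=
  sup [set x : R | exists eps, digits_after d m eps /\
     x = sum1 (fun j => (-1) ^+ j * (eps (m + j)%N)%:R / (dprod d m j)%:R)].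

Definition negaD_g (R : realType) (d c : nat -> nat) (m : nat) : R :=
  \sum_(1 <= i < m.+1) ((-1) ^+ i * (c i)%:R / (dprod d 0 i)%:R).

(* Main.v *)
Require Import Defs.
From HB Require Import structures.
From mathcomp Require Import all_boot all_order all_algebra.
From mathcomp Require Import all_classical all_reals all_analysis.
From mathcomp Require Import ring lra.

Import Order.TTheory GRing.Theory Num.Theory.
Import numFieldNormedType.Exports.

Local Open Scope classical_set_scope.
Local Open Scope ring_scope.

(** Cutting a nega-[D] series after [m] digits gives [g_m] plus
    [(-1)^m / (d_1 ... d_m)] times the tail formed by the remaining digits, and
    those digits are free; so the cylinder is an affine image of the set [S_m]
    of all tails ([negaD_cylinderE]).  Everything reduces to the equality
    [S_k = [A_k - 1, A_k]], where
    [A_k = 1/d_(k+1) - 1/(d_(k+1) d_(k+2)) + ...]; it yields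
    [a_m = sup S_m = A_m], and at [k = 0] it shows that every nega-[D] value
    lies in [[a_0 - 1, a_0]].

    Both inclusions rest on two recursions obtained by removing the first
    digit: a tail [t_k] with first digit [e] satisfies
    [d_(k+1) t_k = - (e + t_(k+1))], and [d_(k+1) A_k = 1 - A_(k+1)].
    - A finite tail lies in [[A_k - 1, A_k]] by induction on its length: the
      empty one is [0], and prepending a digit preserves the property
      ([tail_part_itv]).  The interval is closed, so infinite tails lie in it.
    - Conversely, the digits [0, ..., d_(k+1) - 1] send the intervals
      [[A_(k+1) - 1, A_(k+1)]] onto adjacent unit intervals covering
      [d_(k+1) [A_k - 1, A_k]], hence any [x] in [[A_k - 1, A_k]] has a first
      digit whose remainder lies in the next interval ([exists_digit]).
      Iterating produces digits whose partial sums differ from [x] by at most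
      [1 / (d_(k+1) ... d_(k+n)) <= 2^-n] ([tail_sum_surj]).

    The affine map preserves or reverses the interval according to the sign
    [(-1)^m]. *)

(** * Products of bases *)

Lemma dprodSl (d : nat -> nat) (k n : nat) :
  dprod d k n.+1 = (d k.+1 * dprod d k.+1 n)%N.
Proof. by rewrite /dprod big_ltn ?ltnS ?addnS ?ltnS ?leq_addr// addSn. Qed.

Lemma dprodSr (d : nat -> nat) (k n : nat) :
  dprod d k n.+1 = (dprod d k n * d (k + n.+1))%N.
Proof. by rewrite /dprod addnS big_nat_recr//= ltnS leq_addr. Qed.

Lemma dprod0 (d : nat -> nat) (k : nat) : dprod d k 0 = 1%N.
Proof. by rewrite /dprod addn0 big_geq. Qed.

Lemma dprod_ge_expn2 (d : nat -> nat) (k n : nat)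
    (hd : forall n, (1 <= n)%N -> (2 <= d n)%N) : (2 ^ n <= dprod d k n)%N.
Proof.
elim: n k => [|n IH] k; first by rewrite dprod0.
by rewrite dprodSl expnS leq_mul// hd.
Qed.

Lemma dprod_gt0 (d : nat -> nat) (k n : nat)
    (hd : forall n, (1 <= n)%N -> (2 <= d n)%N) : (0 < dprod d k n)%N.
Proof. by rewrite (leq_trans _ (dprod_ge_expn2 d k n hd))// expn_gt0. Qed.

(** Shifting the upper bound by one matches the partial sums indexed by their
    number of terms. *)
Lemma sum1_cvg (R : realType) (u : nat -> R) (l : R) :
  (fun N => \sum_(1 <= n < N.+1) u n) @ \oo --> l -> sum1 u = l.
Proof.
move=> ul; apply: (cvg_lim (@Rhausdorff R)).
by rewrite -(cvg_shiftS (fun N => \sum_(1 <= n < N) u n)).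
Qed.

(** * Tails of a nega-D series *)

(** The [j]-th term of the nega-[D] series whose digits are read after
    position [k]. *)
Definition tail_term (R : realType) (d : nat -> nat) (k : nat)
    (eps : nat -> nat) (j : nat) : R :=
  (-1) ^+ j * (eps (k + j)%N)%:R / (dprod d k j)%:R.

(** The sum of its first [N] terms. *)
Definition tail_part (R : realType) (d : nat -> nat) (k : nat)
    (eps : nat -> nat) (N : nat) : R :=
  \sum_(1 <= j < N.+1) tail_term R d k eps j.

(** The value of the whole tail. *)
Definition tail_sum (R : realType) (d : nat -> nat) (k : nat)
    (eps : nat -> nat) : R := sum1 (tail_term R d k eps).

(** The alternating series [a_k = 1/d_(k+1) - 1/(d_(k+1) d_(k+2)) + ...];
    for [k = 0] it is the number [a_0]. *)
Definition alt_sum (R : realType) (d : nat -> nat) (k : nat) : R :=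
  sum1 (fun n => (-1) ^+ n.+1 / (dprod d k n)%:R).

Lemma tail_part0 (R : realType) d k eps : tail_part R d k eps 0 = 0.
Proof. by rewrite /tail_part big_geq. Qed.

(** Removing the first digit of a finite tail. *)
Lemma tail_partSl (R : realType) (d : nat -> nat) (k : nat) (eps : nat -> nat)
    (N : nat) (hd : forall n, (1 <= n)%N -> (2 <= d n)%N) :
  tail_part R d k eps N.+1 =
  - ((eps k.+1)%:R + tail_part R d k.+1 eps N) / (d k.+1)%:R.
Proof.
have d0 : (d k.+1)%:R != 0 :> R by rewrite pnatr_eq0 -lt0n ltnW// hd.
rewrite /tail_part big_ltn// big_add1 /= mulNr mulrDl opprD; congr (_ + _).
  by rewrite /tail_term addn1 dprodSl dprod0 muln1 expr1 mulN1r mulNr.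
rewrite mulr_suml -sumrN; apply: eq_bigr => j _.
have q0 : (dprod d k.+1 j)%:R != 0 :> R.
  by rewrite pnatr_eq0 -lt0n dprod_gt0.
by rewrite /tail_term dprodSl addSnnS natrM exprS; field; rewrite d0.
Qed.

(** A digit is less than its own base, so it cancels the last factor of the
    denominator, and the others are at least [2]. *)
Lemma tail_termN_le (R : realType) (d : nat -> nat) (k : nat)
    (eps : nat -> nat) (j : nat) (hd : forall n, (1 <= n)%N -> (2 <= d n)%N) :
  digits_after d k eps ->
  `|tail_term R d k eps j.+1| <= geometric 1 2^-1 j.
Proof.
move=> he; rewrite /geometric /= mul1r /tail_term.
rewrite !normrM normrX normrN1 expr1n mul1r !normfV !normr_nat.
have d0 : 0 < (d (k + j.+1)%N)%:R :> R.
  by rewrite ltr0n ltnW// hd// addnS.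
have q0 : 0 < (dprod d k j)%:R :> R by rewrite ltr0n dprod_gt0.
rewrite dprodSr natrM invfM mulrCA.
apply: (@le_trans _ _ (dprod d k j)%:R^-1).
  rewrite ler_piMr ?invr_ge0 ?ltW// ltr_pdivrMr// mul1r ltr_nat.
  by apply: he; rewrite addnS ltnS leq_addr.
rewrite exprVn lef_pV2 ?posrE ?exprn_gt0//.
by rewrite -natrX ler_nat dprod_ge_expn2.
Qed.

Lemma tail_part_cvg (R : realType) (d : nat -> nat) (k : nat)
    (eps : nat -> nat) (hd : forall n, (1 <= n)%N -> (2 <= d n)%N) :
  digits_after d k eps ->
  tail_part R d k eps @ \oo --> tail_sum R d k eps.
Proof.
move=> he.
have cv : cvgn (tail_part R d k eps).
  have -> : tail_part R d k eps = series (fun j => tail_term R d k eps j.+1).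
    by apply/funext => N; rewrite /tail_part big_add1.
  apply: normed_cvg.
  apply: (@series_le_cvg _ _ (geometric 1 2^-1)) => [n|n|n|] /=.
  - exact: normr_ge0.
  - by rewrite mul1r exprn_ge0// invr_ge0.
  - exact: tail_termN_le.
  - by apply: is_cvg_geometric_series; rewrite ger0_norm ?invr_ge0// invf_lt1// ltr1n.
by rewrite /tail_sum (@sum1_cvg _ _ (limn (tail_part R d k eps)) cv).
Qed.

Lemma digits_afterS (d : nat -> nat) (k : nat) (eps : nat -> nat) :
  digits_after d k eps -> digits_after d k.+1 eps.
Proof. by move=> he n kn; apply: he; rewrite ltnW. Qed.

Lemma digits_after1 (d : nat -> nat) (k : nat)
    (hd : forall n, (1 <= n)%N -> (2 <= d n)%N) :
  digits_after d k (fun=> 1%N).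
Proof. by move=> n kn; rewrite hd// (leq_trans _ kn). Qed.

Lemma tail_sumS (R : realType) (d : nat -> nat) (k : nat) (eps : nat -> nat)
    (hd : forall n, (1 <= n)%N -> (2 <= d n)%N) :
  digits_after d k eps ->
  tail_sum R d k eps =
  - ((eps k.+1)%:R + tail_sum R d k.+1 eps) / (d k.+1)%:R.
Proof.
move=> he; apply: sum1_cvg.
rewrite -[X in X @ _ --> _]/(tail_part R d k eps).
rewrite -(cvg_shiftS (tail_part R d k eps)).
rewrite (_ : [sequence _]_n = fun N =>
  - ((eps k.+1)%:R + tail_part R d k.+1 eps N) / (d k.+1)%:R); last first.
  by apply/funext => N; rewrite /= tail_partSl.
apply: cvgM; last exact: cvg_cst.
apply: cvgN; apply: cvgD; first exact: cvg_cst.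
by apply: tail_part_cvg => //; exact: digits_afterS.
Qed.

(** A tail splits into a finite part and a rescaled later tail. *)
Lemma tail_sum_split (R : realType) (d : nat -> nat) (k m : nat)
    (eps : nat -> nat) (hd : forall n, (1 <= n)%N -> (2 <= d n)%N) :
  digits_after d k eps ->
  tail_sum R d k eps = tail_part R d k eps m
    + (-1) ^+ m / (dprod d k m)%:R * tail_sum R d (k + m) eps.
Proof.
elim: m k => [|m IH] k he.
  by rewrite tail_part0 dprod0 addn0 add0r expr0 invr1 !mul1r.
have d0 : (d k.+1)%:R != 0 :> R by rewrite pnatr_eq0 -lt0n ltnW// hd.
have q0 : (dprod d k.+1 m)%:R != 0 :> R.
  by rewrite pnatr_eq0 -lt0n dprod_gt0.
rewrite tail_sumS// IH; last exact: digits_afterS.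
rewrite tail_partSl// dprodSl addSnnS natrM exprS.
by field; rewrite q0.
Qed.

(** [alt_sum] is the opposite of the tail whose digits are all [1], which are
    admissible since every base is at least [2]; facts on tails thus apply to
    it. *)
Lemma alt_sumE (R : realType) (d : nat -> nat) (k : nat)
    (hd : forall n, (1 <= n)%N -> (2 <= d n)%N) :
  alt_sum R d k = - tail_sum R d k (fun=> 1%N).
Proof.
apply: sum1_cvg.
rewrite (_ : (fun N => _) = fun N => - tail_part R d k (fun=> 1%N) N).
  by apply: cvgN; apply: tail_part_cvg => //; exact: digits_after1.
apply/funext => N; rewrite /tail_part -sumrN; apply: eq_bigr => j _.
by rewrite /tail_term mulr1 exprS mulN1r mulNr.
Qed.

Lemma alt_sumS (R : realType) (d : nat -> nat) (k : nat)
    (hd : forall n, (1 <= n)%N -> (2 <= d n)%N) :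
  (d k.+1)%:R * alt_sum R d k = 1 - alt_sum R d k.+1.
Proof.
have d0 : (d k.+1)%:R != 0 :> R by rewrite pnatr_eq0 -lt0n ltnW// hd.
rewrite !alt_sumE// tail_sumS; [|done|exact: digits_after1].
by field.
Qed.

Lemma alt_sum_itv (R : realType) (d : nat -> nat) (k : nat)
    (hd : forall n, (1 <= n)%N -> (2 <= d n)%N) :
  0 <= alt_sum R d k <= 1.
Proof.
have bnd N : -1 <= tail_part R d k (fun=> 1%N) N <= 0.
  elim: N k => [|N IH] k; first by rewrite tail_part0 lexx lerN10.
  have d1 : 1 <= (d k.+1)%:R :> R by rewrite ler1n ltnW// hd.
  rewrite tail_partSl// ler_pdivlMr ?ler_pdivrMr ?(lt_le_trans ltr01)//.
  by have /andP[] := IH k.+1; lra.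
have cv := @tail_part_cvg R d k _ hd (@digits_after1 d k hd).
rewrite alt_sumE// oppr_ge0 lerNl.
rewrite -(cvg_lim (@Rhausdorff R) cv).
have icv : cvgn (tail_part R d k (fun=> 1%N)) by apply/cvg_ex; eexists; exact: cv.
apply/andP; split.
  by apply: limr_le => //; apply: nearW => N; case/andP: (bnd N).
by apply: limr_ge => //; apply: nearW => N; case/andP: (bnd N).
Qed.

(** * The set of all tails *)

(** The empty partial sum lies in [[a_k - 1, a_k]], and prepending a digit
    preserves this because [d_(k+1) a_k = 1 - a_(k+1)]. *)
Lemma tail_part_itv (R : realType) (d : nat -> nat) (k : nat)
    (eps : nat -> nat) (N : nat)
    (hd : forall n, (1 <= n)%N -> (2 <= d n)%N) :
  digits_after d k eps ->
  alt_sum R d k - 1 <= tail_part R d k eps N <= alt_sum R d k.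
Proof.
elim: N k => [|N IH] k he.
  by rewrite tail_part0; have /andP[] := alt_sum_itv R d k hd; lra.
have d0 : 0 < (d k.+1)%:R :> R by rewrite ltr0n ltnW// hd.
have e0 : 0 <= (eps k.+1)%:R :> R by rewrite ler0n.
have e1 : (eps k.+1)%:R + 1 <= (d k.+1)%:R :> R by rewrite natr1 ler_nat he.
rewrite tail_partSl// ler_pdivlMr ?ler_pdivrMr//.
have := alt_sumS R d k hd.
have /andP[] := IH k.+1 (digits_afterS _ _ _ he).
by rewrite ![_ * (d _)%:R]mulrC mulrBr; lra.
Qed.

Lemma tail_sum_itv (R : realType) (d : nat -> nat) (k : nat)
    (eps : nat -> nat) (hd : forall n, (1 <= n)%N -> (2 <= d n)%N) :
  digits_after d k eps ->
  alt_sum R d k - 1 <= tail_sum R d k eps <= alt_sum R d k.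
Proof.
move=> he; have cv := @tail_part_cvg R d k _ hd he.
rewrite -(cvg_lim (@Rhausdorff R) cv).
have icv : cvgn (tail_part R d k eps) by apply/cvg_ex; eexists; exact: cv.
apply/andP; split.
  by apply: limr_ge => //; apply: nearW => N; case/andP: (tail_part_itv R d k eps N hd he).
by apply: limr_le => //; apply: nearW => N; case/andP: (tail_part_itv R d k eps N hd he).
Qed.

(** Also at the right endpoint [z = n], where the floor of [z] would be too
    large, the integer [e] stays below [n]. *)
Lemma nat_floor_lt (R : realType) (n : nat) (z : R) : (0 < n)%N ->
  0 <= z <= n%:R -> exists2 e, (e < n)%N & e%:R <= z <= e%:R + 1.
Proof.
case: n => // n _; elim: n => [|n IH] /andP[z0 zn].
  by exists 0%N; rewrite // z0 add0r.
have [zn1|nz] := lerP z n.+1%:R.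
  have [|e en ez] := IH; first by rewrite z0.
  by exists e => //; rewrite ltnW.
by exists n.+1; rewrite // (ltW nz) natr1.
Qed.

(** One step of the greedy expansion: a first digit can be chosen so that the
    remainder stays in the next interval. *)
Lemma exists_digit (R : realType) (d : nat -> nat)
    (hd : forall n, (1 <= n)%N -> (2 <= d n)%N) (p : nat * R) :
  exists e, alt_sum R d p.1 - 1 <= p.2 <= alt_sum R d p.1 ->
    (e < d p.1.+1)%N /\
    alt_sum R d p.1.+1 - 1 <= - (e%:R + (d p.1.+1)%:R * p.2)
      <= alt_sum R d p.1.+1.
Proof.
case: p => k y /=; have [yA|] := boolP (_ <= y <= _); last by exists 0%N.
have d0 : 0 < (d k.+1)%:R :> R by rewrite ltr0n ltnW// hd.
case/andP: yA; rewrite -(ler_pM2l d0) -[y <= _](ler_pM2l d0) mulrBr mulr1.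
rewrite alt_sumS// => y1 y2.
(* The remainder - (e + d y) lies in [A - 1, A], A being the next alternating
   sum, exactly when e is within 1 below 1 - A - d y. *)
have [||e ed ez] := @nat_floor_lt R (d k.+1)
  (1 - alt_sum R d k.+1 - (d k.+1)%:R * y); first by rewrite ltnW// hd.
  by apply/andP; split; lra.
by exists e => _; split=> //; move/andP: ez => []; lra.
Qed.

(** Iterating [exists_digit] expands any point of the interval. *)
Lemma tail_sum_surj (R : realType) (d : nat -> nat) (k : nat) (x : R)
    (hd : forall n, (1 <= n)%N -> (2 <= d n)%N) :
  alt_sum R d k - 1 <= x <= alt_sum R d k ->
  exists2 eps, digits_after d k eps & tail_sum R d k eps = x.
Proof.
move=> xA; have [dig digP] := choice (exists_digit R d hd).
(* X n is the remainder of x after n digits. *)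
pose X := fix X n := if n is n'.+1 then
  - ((dig ((k + n')%N, X n'))%:R + (d (k + n').+1)%:R * X n') else x.
pose eps i := dig (i.-1, X (i.-1 - k)%N).
have XA n : alt_sum R d (k + n) - 1 <= X n <= alt_sum R d (k + n).
  elim: n => [|n IH]; first by rewrite addn0.
  by rewrite addnS; have [] := digP ((k + n)%N, X n) IH.
have epsE n : eps (k + n).+1 = dig ((k + n)%N, X n).
  by rewrite /eps /= addKn.
have he : digits_after d k eps.
  case=> // i; rewrite ltnS => ki; rewrite -(subnKC ki) epsE.
  by have [] := digP ((k + (i - k))%N, X (i - k)%N) (XA _).
exists eps => //.
(* The remainder is what the partial sums leave out. *)
have partE n : tail_part R d k eps n =
    x - (-1) ^+ n / (dprod d k n)%:R * X n.
  elim: n => [|n IH].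
    by rewrite tail_part0 dprod0 expr0 invr1 !mul1r subrr.
  have d0 : (d (k + n).+1)%:R != 0 :> R by rewrite pnatr_eq0 -lt0n ltnW// hd.
  have q0 : (dprod d k n)%:R != 0 :> R by rewrite pnatr_eq0 -lt0n dprod_gt0.
  rewrite /tail_part big_nat_recr//= -/(tail_part R d k eps n) IH /tail_term.
  rewrite dprodSr addnS epsE natrM exprS.
  by field; rewrite d0.
apply: sum1_cvg; rewrite -[X in X @ _ --> _]/(tail_part R d k eps).
rewrite (_ : tail_part R d k eps =
  fun n => x - (-1) ^+ n / (dprod d k n)%:R * X n); last exact/funext.
rewrite -[X in _ --> X]subr0; apply: cvgB; first exact: cvg_cst.
apply: norm_cvg0; apply: (squeeze_cvgr (f := cst 0) (h := geometric 1 2^-1)).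
- apply: nearW => n; rewrite /= normr_ge0 mul1r /=.
  rewrite !normrM normrX normrN1 expr1n mul1r normfV normr_nat exprVn.
  (* |X n| <= 1 because [A - 1, A] with 0 <= A <= 1 lies in [-1, 1]. *)
  rewrite -[leRHS]mulr1 ler_pM ?invr_ge0//.
    rewrite lef_pV2 ?posrE ?exprn_gt0 ?ltr0n ?dprod_gt0//.
    by rewrite -natrX ler_nat dprod_ge_expn2.
  have := XA n; have := alt_sum_itv R d (k + n) hd.
  by move=> /andP[? ?] /andP[? ?]; rewrite ler_norml; apply/andP; split; lra.
- exact: cvg_cst.
- by apply: cvg_geometric; rewrite ger0_norm ?invr_ge0// invf_lt1// ltr1n.
Qed.

Lemma negaD_a_alt_sum (R : realType) (d : nat -> nat) (m : nat)
    (hd : forall n, (1 <= n)%N -> (2 <= d n)%N) :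
  negaD_a R d m = alt_sum R d m.
Proof.
rewrite /negaD_a (_ : [set x | _] = `[alt_sum R d m - 1, alt_sum R d m]%classic).
  by rewrite sup_itvcc// gerBl.
apply/seteqP; split=> x /=; rewrite in_itv /=.
  by move=> [eps [he ->]]; exact: tail_sum_itv.
by move=> /(tail_sum_surj _ _ _ _ hd)[eps he <-]; exists eps.
Qed.

(** * Cylinders as affine images *)

Lemma eq_tail_part (R : realType) (d : nat -> nat) (k m : nat)
    (e1 e2 : nat -> nat) :
  (forall i, (k < i <= k + m)%N -> e1 i = e2 i) ->
  tail_part R d k e1 m = tail_part R d k e2 m.
Proof.
move=> e12; apply: eq_big_nat => j /andP[j0 jm].
by rewrite /tail_term e12// -addn1 leq_add2l j0 leq_add2l.
Qed.

Lemma eq_tail_sum (R : realType) (d : nat -> nat) (k : nat)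
    (e1 e2 : nat -> nat) :
  (forall i, (k < i)%N -> e1 i = e2 i) ->
  tail_sum R d k e1 = tail_sum R d k e2.
Proof.
move=> e12; rewrite /tail_sum /sum1.
suff -> : (fun N => \sum_(1 <= n < N) tail_term R d k e1 n) =
          (fun N => \sum_(1 <= n < N) tail_term R d k e2 n) by [].
apply/funext => N; apply: eq_big_nat => j /andP[j0 _].
by rewrite /tail_term e12// -addn1 leq_add2l.
Qed.

Lemma negaD_cylinderE (R : realType) (d : nat -> nat) (m : nat)
    (c : nat -> nat)
    (hd : forall n, (1 <= n)%N -> (2 <= d n)%N)
    (hc : forall i, (1 <= i <= m)%N -> (c i < d i)%N) :
  negaD_cylinder R d m c =
  (fun t => negaD_g R d c m + (-1) ^+ m / (dprod d 0 m)%:R * t) @`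
    `[negaD_a R d m - 1, negaD_a R d m]%classic.
Proof.
rewrite negaD_a_alt_sum//; apply/seteqP; split=> x /=.
  move=> [_ [eps [he ec ->]]]; exists (tail_sum R d m eps).
    by rewrite /= in_itv/=; apply: tail_sum_itv => // i mi; rewrite he// (leq_trans _ mi).
  rewrite -[negaD R d eps]/(tail_sum R d 0 eps) (tail_sum_split _ _ 0 m)//.
  congr (_ + _); apply/esym; exact: (eq_tail_part _ _ 0 m).
move=> [t]; rewrite in_itv /= => /(tail_sum_surj _ _ _ _ hd)[e he <-] <-.
(* The prefix c followed by the digits of the tail. *)
pose eps i := if (i <= m)%N then c i else e i.
have heps : digits_after d 0 eps.
  by move=> i i0; rewrite /eps; case: (leqP i m) => im; [rewrite hc// i0|exact: he].
have E : negaD_g R d c m + (-1) ^+ m / (dprod d 0 m)%:R * tail_sum R d m e =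
    tail_sum R d 0 eps.
  rewrite (tail_sum_split R d 0 m eps hd heps); congr (_ + _ * _).
    by apply: (eq_tail_part R d 0 m c eps) => i /andP[_ im]; rewrite /eps im.
  by apply: eq_tail_sum => i mi; rewrite /eps leqNgt mi.
rewrite E; split.
  by rewrite in_itv; exact: tail_sum_itv.
by exists eps; split=> // i /andP[_ im]; rewrite /eps im.
Qed.

Lemma affine_image_itvcc (R : realFieldType) (g s u v : R) : 0 < s ->
  (fun t => g + s * t) @` `[u, v]%classic = `[g + s * u, g + s * v]%classic.
Proof.
move=> s0; apply/seteqP; split=> x /=.
  by move=> [t]; rewrite !in_itv /= => /andP[ut tv] <-; rewrite !lerD2l !ler_pM2l// ut.
rewrite in_itv /= => /andP[ux xv]; exists ((x - g) / s).
  by rewrite in_itv /= ler_pdivlMr// ler_pdivrMr// !lerBrDl !lerBlDl ![_ * s]mulrC ux.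
by rewrite mulrC divfK ?gt_eqF// addrC subrK.
Qed.

Lemma affine_image_itvcc_neg (R : realFieldType) (g s u v : R) : s < 0 ->
  (fun t => g + s * t) @` `[u, v]%classic = `[g + s * v, g + s * u]%classic.
Proof.
move=> s0; apply/seteqP; split=> x /=.
  by move=> [t]; rewrite !in_itv /= => /andP[ut tv] <-; rewrite !lerD2l !ler_nM2l// ut tv.
rewrite in_itv /= => /andP[vx xu]; exists ((x - g) / s).
  by rewrite in_itv /= ler_ndivlMr// ler_ndivrMr// !lerBrDl !lerBlDl ![_ * s]mulrC vx xu.
by rewrite mulrC divfK ?lt_eqF// addrC subrK.
Qed.

Theorem lemma14 (R : realType) (d : nat -> nat) (m : nat) (c : nat -> nat)
    (hd : forall n, (1 <= n)%N -> (2 <= d n)%N)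
    (hm : (1 <= m)%N)
    (hc : forall i, (1 <= i <= m)%N -> (c i < d i)%N) :
  (exists a b : R, a < b /\ negaD_cylinder R d m c = `[a, b]%classic) /\
  (~~ odd m ->
     negaD_cylinder R d m c =
       `[negaD_g R d c m + (-1) ^+ m / (dprod d 0 m)%:R * (negaD_a R d m - 1),
         negaD_g R d c m + (-1) ^+ m / (dprod d 0 m)%:R * negaD_a R d m]%classic) /\
  (odd m ->
     negaD_cylinder R d m c =
       `[negaD_g R d c m + (-1) ^+ m / (dprod d 0 m)%:R * negaD_a R d m,
         negaD_g R d c m + (-1) ^+ m / (dprod d 0 m)%:R * (negaD_a R d m - 1)]%classic).
Proof.
set s : R := (-1) ^+ m / (dprod d 0 m)%:R; set g := negaD_g R d c m.
set a := negaD_a R d m.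
have q0 : 0 < (dprod d 0 m)%:R^-1 :> R by rewrite invr_gt0 ltr0n dprod_gt0.
have even : ~~ odd m -> 0 < s /\
    negaD_cylinder R d m c = `[g + s * (a - 1), g + s * a]%classic.
  move=> em; have s0 : 0 < s by rewrite /s -signr_odd (negbTE em) mul1r.
  by split=> //; rewrite negaD_cylinderE// affine_image_itvcc.
have odd_ : odd m -> s < 0 /\
    negaD_cylinder R d m c = `[g + s * a, g + s * (a - 1)]%classic.
  move=> om; have s0 : s < 0 by rewrite /s -signr_odd om mulN1r oppr_lt0.
  by split=> //; rewrite negaD_cylinderE// affine_image_itvcc_neg.
split; last by split=> [/even[]|/odd_[]].
have [/odd_[s0 ->]|/even[s0 ->]] := boolP (odd m).
  by exists (g + s * a), (g + s * (a - 1)); split=> //; lra.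
by exists (g + s * (a - 1)), (g + s * a); split=> //; lra.
Qed.
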